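(* Let $n\ge 1$, $\phi>1$, $\alpha\le\tfrac{1}{1+1.6\phi}$ and $k\ge 2$. Then there exists a $(\phi,\alpha)$-expander $G=(V,E)$ on $n$ nodes such that with high probability rumor spreading on $G$ with the $k$-PUSH&PULL protocol requires $\Omega(\log_\phi n+\log_k n)$ rounds.
   Context: Graphs are finite, simple, undirected and unweighted. For $S\subseteq V$ let $N(S)=\{v\in V:\exists s\in S,\ \{s,v\}\in E\}$ and $\partial S=N(S)\setminus S$. For $\phi\in(0,n)$ and $\alpha\in(0,\tfrac12]$, a graph $G=(V,E)$ with $n$ nodes is a $(\phi,\alpha)$-expander (small-set vertex expander) if $|\partial S|\ge \phi|S|$ for every $S\subseteq V$ with $0<|S|\le\alpha n$. The $k$-PUSH&PULL protocol: initially one arbitrary node knows a rumor (is informed). The process proceeds in synchronous rounds. In each round every node independently samples $k$ of its neighbors uniformly at random with replacement; every informed node sends the rumor to all the neighbors it sampled (push), and, simultaneously, every uninformed node requests the rumor from all the neighbors it sampled and becomes informed if at least one of them was informed at the start of the round (pull). Informed nodes stay informed. Rumor spreading is completed when all nodes are informed; the number of rounds required is the first round after which this holds. A statement holds with high probability (w.h.p.) if it holds with probability at least $1-n^{-c}$, where $c>0$ is a constant hidden in the asymptotic notation.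
   Formalization: The constant in Ω is uniform over all φ ≥ φ0 for each fixed φ0 > 1 (and may depend on φ0 and c), not over all φ > 1: uniformity fails as φ → 1, since log_φ n is then unbounded while for large k spreading ends within n rounds. *)

(* Defs.v *)
From mathcomp Require Import all_boot all_order all_algebra.
From mathcomp Require Import reals exp.

Set Implicit Arguments.
Unset Strict Implicit.
Unset Printing Implicit Defensive.

Import Order.TTheory GRing.Theory Num.Theory.
Local Open Scope ring_scope.

Section Graphs.
Variable V : finType.
Implicit Types (e : rel V) (S : {set V}).

Definition simple_graph e : Prop := symmetric e /\ irreflexive e.

Definition neighbors e S : {set V} := [set v | [exists s in S, e s v]].

Definition boundary e S : {set V} := neighbors e S :\: S.

Definition is_expander (R : realType) (phi alpha : R) e : Prop :=
  forall S : {set V}, (0 < #|S|)%N -> #|S|%:R <= alpha * #|V|%:R ->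
    phi * #|S|%:R <= #|boundary e S|%:R.

End Graphs.

Section PushPull.
Variables (V : finType) (k : nat).

(* [x v j] is the j-th of the k nodes sampled by v in a given round. *)
Definition round := {ffun V -> {ffun 'I_k -> V}}.

(* A node without neighbors has nobody to contact; letting it sample itself
   transmits nothing and keeps the sampling law a probability. *)
Definition contacts (e : rel V) (v : V) : {set V} :=
  if neighbors e [set v] == set0 then [set v] else neighbors e [set v].

Definition step (I : {set V}) (x : round) : {set V} :=
  [set v | [|| v \in I,
               [exists u in I, [exists j, x u j == v]]
             | [exists j, x v j \in I]]].

(* The set of informed nodes after the first t rounds of w. *)
Definition informed (v0 : V) (w : seq round) (t : nat) : {set V} :=
  foldl step [set v0] (take t w).

(* The first t <= size w such that all nodes are informed after t rounds, and
   (size w).+1 if there is none: this is the completion time truncated at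
   (size w).+1. *)
Definition completion_time (v0 : V) (w : seq round) : nat :=
  find (fun t => informed v0 w t == setT) (iota 0 (size w).+1).

Variable R : realType.

Definition sample_prob (e : rel V) (v u : V) : R :=
  (u \in contacts e v)%:R / #|contacts e v|%:R.

Definition round_prob (e : rel V) (x : round) : R :=
  \prod_(v : V) \prod_(j < k) sample_prob e v (x v j).

(* The probability that the completion time is at least r, computed in the
   space of all h-round executions. It does not depend on h once r <= h. *)
Definition prob_time_ge (e : rel V) (v0 : V) (h : nat) (r : R) : R :=
  \sum_(w : h.-tuple round | r <= (completion_time v0 w)%:R)
     \prod_(x <- w) round_prob e x.

End PushPull.

Definition log (R : realType) (b x : R) : R := ln x / ln b.

(* Main.v *)
(* The graph depends on which of the two logarithms dominates.
   If k < phi, take the complete graph. In a round an informed set I gains at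
   most k |I| nodes by pushing, and the number of successful pulls is a sum of
   independent indicators of mean at most k |I|, so for a <= 1/2
     E exp(a |I'|) <= exp(a (1 + 3k) |I|).
   Iterating with a = (1 + 3k)^-t / 2 gives
     P(all informed after t rounds) <= exp(1/2 - n / (2 (1 + 3k)^t)),
   which beats every power of n when (1 + 3k)^t <= sqrt n.
   If phi <= k, cut the nodes into layers whose sizes grow by a factor b of
   order phi, and join nodes in equal or consecutive layers. Nodes see the much
   larger next layer, which gives the expansion, while the rumor moves by at
   most one layer per round and has to visit the first and the last layer. *)
Require Import Defs.
From mathcomp Require Import all_boot all_order all_algebra.
From mathcomp Require Import reals sequences exp.
From mathcomp Require Import ring lra zify.

Set Implicit Arguments.
Unset Strict Implicit.
Unset Printing Implicit Defensive.

Import Order.TTheory GRing.Theory Num.Theory.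
Local Open Scope ring_scope.

(** * The probability space of executions and one round of the protocol *)

Section Protocol.
Variables (V : finType) (k : nat) (R : realType) (e : rel V).

Implicit Types (I : {set V}) (x : round V k).

Definition exec_prob (w : seq (round V k)) : R := \prod_(x <- w) round_prob R e x.

Lemma contacts_gt0 v : (0 < #|contacts e v|)%N.
Proof.
rewrite /contacts; case: ifPn => [_|]; first by rewrite cards1.
by rewrite card_gt0.
Qed.

Lemma sample_prob_ge0 v u : 0 <= sample_prob R e v u.
Proof. by rewrite /sample_prob divr_ge0. Qed.

Lemma sum_sample_prob v : \sum_u sample_prob R e v u = 1.
Proof.
rewrite /sample_prob -mulr_suml -natr_sum.
rewrite [X in X%:R / _](_ : _ = #|contacts e v|); last first.
  by rewrite -sum1_card [RHS]big_mkcond; apply: eq_bigr => u _; case: (u \in _).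
by rewrite divff // pnatr_eq0 -lt0n contacts_gt0.
Qed.

Lemma round_prob_ge0 x : 0 <= round_prob R e x.
Proof.
by rewrite /round_prob; do 2!(apply: prodr_ge0 => ? _); apply: sample_prob_ge0.
Qed.

Lemma exec_prob_ge0 w : 0 <= exec_prob w.
Proof. by apply: prodr_ge0 => x _; apply: round_prob_ge0. Qed.

(** Independence of the samples: distributing the products over the sums turns the mean of a product
    into the product of the means. *)
Lemma sum_round_prob_prod (g : V -> V -> R) :
  \sum_x round_prob R e x * \prod_v \prod_(j < k) g v (x v j) =
  \prod_v \prod_(j < k) \sum_u sample_prob R e v u * g v u.
Proof.
under [RHS]eq_bigr do rewrite bigA_distr_bigA.
rewrite bigA_distr_bigA /=; apply: eq_bigr => x _.
rewrite /round_prob -big_split; apply: eq_bigr => v _.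
by rewrite -big_split.
Qed.

Lemma sum_round_prob : \sum_(x : round V k) round_prob R e x = 1.
Proof.
transitivity (\prod_(v : V) \prod_(j < k) \sum_u sample_prob R e v u * 1).
  rewrite -sum_round_prob_prod; apply: eq_bigr => x _.
  by rewrite big1 ?mulr1 // => v _; rewrite big1.
rewrite big1// => v _; rewrite big1// => j _.
by under eq_bigr do rewrite mulr1; apply: sum_sample_prob.
Qed.

Lemma sum_tuple_cons (T : finType) h (F : seq T -> R) :
  \sum_(w : h.+1.-tuple T) F w = \sum_x \sum_(w : h.-tuple T) F (x :: w).
Proof.
rewrite pair_big /=.
rewrite (reindex (fun p : T * h.-tuple T => cons_tuple p.1 p.2)) //=.
exists (fun w => (thead w, behead_tuple w)) => [[x w]|w] _ /=.
  by congr pair; apply/val_inj.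
by apply/val_inj; rewrite /= [in RHS](tuple_eta w).
Qed.

(** Conditioning on the first round, for inductions over the rounds. *)
Lemma sum_exec_prob_cons h (F : seq (round V k) -> R) :
  \sum_(w : h.+1.-tuple (round V k)) exec_prob w * F w =
  \sum_x round_prob R e x *
    \sum_(w : h.-tuple (round V k)) exec_prob w * F (x :: w).
Proof.
rewrite (sum_tuple_cons h (fun w => exec_prob w * F w)); apply: eq_bigr => x _.
rewrite mulr_sumr; apply: eq_bigr => w _.
by rewrite /exec_prob big_cons mulrA.
Qed.

Lemma sum_exec_prob h : \sum_(w : h.-tuple (round V k)) exec_prob w = 1.
Proof.
elim: h => [|h IH].
  rewrite (big_pred1 [tuple]) => [|w]; first by rewrite /exec_prob big_nil.
  by rewrite [w]tuple0; apply/esym/eqP.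
under eq_bigr do rewrite -[exec_prob _]mulr1.
rewrite (sum_exec_prob_cons h (fun=> 1)).
rewrite -[RHS]sum_round_prob; apply: eq_bigr => x _.
by under eq_bigr do rewrite mulr1; rewrite IH mulr1.
Qed.

Lemma prob_time_geE (v0 : V) h (r : R) :
  prob_time_ge k e v0 h r =
  1 - \sum_(w : h.-tuple (round V k) | (completion_time v0 w)%:R < r)
        exec_prob w.
Proof.
rewrite -[X in X - _](sum_exec_prob h).
rewrite [X in X - _](bigID (fun w : h.-tuple _ => r <= (completion_time v0 w)%:R)) /=.
under [X in _ + X - _]eq_bigl do rewrite -ltNge.
by rewrite addrK.
Qed.

Lemma prob_time_ge1 (v0 : V) h (r : R) :
  (forall w : h.-tuple (round V k), exec_prob w != 0 ->
     r <= (completion_time v0 w)%:R) ->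
  prob_time_ge k e v0 h r = 1.
Proof.
move=> H; rewrite prob_time_geE big1 ?subr0 // => w.
by apply: contraTeq => /H; rewrite leNgt.
Qed.

Lemma completion_time_informed (v0 : V) (w : seq (round V k)) :
  (completion_time v0 w <= size w)%N ->
  informed v0 w (completion_time v0 w) = setT.
Proof.
set a := fun t => informed v0 w t == setT => le_w.
have hasw : has a (iota 0 (size w).+1) by rewrite has_find size_iota.
have := nth_find 0%N hasw; rewrite nth_iota ?add0n //.
by move/eqP.
Qed.

Lemma subset_step I x : I \subset step I x.
Proof. by apply/subsetP => v vI; rewrite inE vI. Qed.

Lemma informed_mono (v0 : V) (w : seq (round V k)) s t :
  (s <= t)%N -> informed v0 w s \subset informed v0 w t.
Proof.
move=> /subnKC <-; rewrite /informed takeD foldl_cat.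
elim: (take (t - s) _) (foldl _ _ _) => //= x u IH I.
exact: subset_trans (subset_step I x) (IH _).
Qed.

Lemma completion_time_gt0 (v0 : V) (w : seq (round V k)) :
  (1 < #|V|)%N -> (0 < completion_time v0 w)%N.
Proof.
rewrite lt0n => V2; apply/eqP => c0; have := completion_time_informed (v0 := v0) (w := w).
rewrite c0 /informed take0 /= => /(_ isT)/(congr1 (fun A : {set V} => #|A|)).
by rewrite cards1 cardsT => V1; rewrite -V1 in V2.
Qed.

(** Old nodes and push targets account for [k.+1 * #|I|]. Successful pulls are overcounted, over all
    nodes and all samples, so that they form a sum of independent indicators. *)
Lemma card_step I x :
  (#|step I x| <= k.+1 * #|I| + \sum_v \sum_(j < k) (x v j \in I))%N.
Proof.
pose push := [set x p.1 p.2 | p in setX I [set: 'I_k]].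
pose pull := [set v | [exists j, x v j \in I]].
have sub : step I x \subset (I :|: push) :|: pull.
  apply/subsetP => v; rewrite !inE => /or3P[-> //| |->]; last by rewrite orbT.
  case/existsP => u /andP[uI /existsP[j /eqP xuj]].
  apply/orP; left; apply/orP; right; apply/imsetP; exists (u, j) => //.
  by rewrite !inE uI.
apply: leq_trans (subset_leq_card sub) _.
apply: leq_trans (leq_card_setU _ _) _; apply: leq_add.
  apply: leq_trans (leq_card_setU _ _) _; rewrite mulSn leq_add2l.
  by apply: leq_trans (leq_imset_card _ _) _; rewrite cardsX cardsT card_ord mulnC.
rewrite -sum1dep_card big_mkcond /=; apply: leq_sum => v _.
case: existsP => // -[j xj].
by rewrite (bigD1 j) //= xj.
Qed.

(** From 1 - a <= e^(-a) one gets (1 - a) e^a <= 1, while (1 - a)(1 + 2a) >= 1 on this range. *)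
Lemma expR_le1D2x (a : R) : 0 <= a <= 1 / 2 -> expR a <= 1 + 2 * a.
Proof.
move=> /andP[a0 a1]; have := expR_ge1Dx (- a); have := expR_gt0 a.
rewrite expRN => e0 H.
have : (1 - a) * expR a <= 1 by rewrite -ler_pdivlMr // div1r.
nra.
Qed.

(** * Exponential moments of the number of informed nodes *)

Section ExponentialMoment.
Variable B : R.
(** For a fixed j, [B] bounds the expected number of nodes whose j-th sample is [u]. *)
Hypothesis le_B : forall u, \sum_v sample_prob R e v u <= B.

(** [1 + k] stands for old nodes and pushes, [k * B] for the mean number of pulls per informed node;
    the factor 2 is the loss in [expR_le1D2x]. *)
Let growth : R := 1 + k%:R + 2 * k%:R * B.

Lemma round_exp_moment I (a : R) : 0 <= a <= 1 / 2 ->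
  \sum_(x : round V k) round_prob R e x * expR (a * #|step I x|%:R) <=
  expR (growth * a * #|I|%:R).
Proof.
move=> ha; have [a0 _] := andP ha.
pose g (v u : V) := expR (a * (u \in I)%:R).
apply: (@le_trans _ _ (\sum_(x : round V k) round_prob R e x *
    (expR (a * (1 + k%:R) * #|I|%:R) * \prod_v \prod_(j < k) g v (x v j)))).
  apply: ler_sum => x _; apply: ler_wpM2l; first exact: round_prob_ge0.
  under eq_bigr do rewrite -expR_sum.
  rewrite -expR_sum -expRD ler_expR -mulrA.
  under eq_bigr do rewrite -mulr_sumr.
  rewrite -mulr_sumr -mulrDr ler_wpM2l //.
  under eq_bigr do rewrite -natr_sum.
  by rewrite -natr_sum nat1r -natrM -natrD ler_nat card_step.
under eq_bigr do rewrite mulrCA.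
rewrite -mulr_sumr sum_round_prob_prod /growth.
have -> : (1 + k%:R + 2 * k%:R * B) * a * #|I|%:R =
  a * (1 + k%:R) * #|I|%:R + k%:R * (2 * a) * (#|I|%:R * B) by ring.
rewrite expRD ler_wpM2l ?expR_ge0 //.
pose p v := \sum_(u in I) sample_prob R e v u.
apply: (@le_trans _ _ (\prod_v \prod_(j < k) expR (2 * a * p v))).
  apply: ler_prod => v _; rewrite prodr_ge0 /=; last first.
    by move=> j _; apply: sumr_ge0 => u _; rewrite mulr_ge0 ?expR_ge0 ?sample_prob_ge0.
  apply: ler_prod => j _; apply/andP; split.
    by apply: sumr_ge0 => u _; rewrite mulr_ge0 ?expR_ge0 ?sample_prob_ge0.
  (* A single sample hits [I] with probability p = [p v], so its factor has mean 1 + (e^a - 1) p <=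
     1 + 2ap <= e^(2ap). *)
  apply: le_trans (expR_ge1Dx _).
  rewrite -[X in _ <= X + _](sum_sample_prob v) mulr_sumr [X in _ + X]big_mkcond -big_split /=.
  apply: ler_sum => u _; rewrite /g; have := sample_prob_ge0 v u.
  case: (u \in I) => p0; last by rewrite mulr0 expR0 mulr1 addr0.
  rewrite mulr1; have := ler_wpM2l p0 (expR_le1D2x ha). lra.
under eq_bigr do rewrite prodr_const card_ord -expRM_natl.
rewrite -expR_sum ler_expR -mulr_sumr -mulr_sumr mulrA.
(* Summing [p v] over the requesting nodes first bounds the total by [B] for each informed node. *)
rewrite ler_wpM2l ?mulr_ge0 // exchange_big /= mulr_natl -sumr_const.
by apply: ler_sum => u _; apply: le_B.
Qed.

(* Induction from the last round backwards: each earlier round multiplies the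
   coefficient of the cardinal by [growth], and it must stay below 1/2 for
   [round_exp_moment] to apply. *)
Lemma informed_all_exp_moment (a : R) t h I : 0 <= a -> 1 <= growth ->
  growth ^+ t * a <= 1 / 2 -> (t <= h)%N ->
  \sum_(w : h.-tuple (round V k))
     exec_prob w * (foldl (@step V k) I (take t w) == setT)%:R <=
  expR (growth ^+ t * a * #|I|%:R - a * #|V|%:R).
Proof.
move=> a0 g1; elim: t h I => [|t IH] h I.
  move=> _ _; rewrite expr0 mul1r.
  under eq_bigr do rewrite take0 /=.
  rewrite -mulr_suml sum_exec_prob mul1r.
  case: eqP => [->|_]; last exact: expR_ge0.
  by rewrite cardsT subrr expR0.
case: h => // h ha th.
have ga0 : 0 <= growth ^+ t * a by rewrite mulr_ge0 ?exprn_ge0 // (le_trans _ g1).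
have ha' : growth ^+ t * a <= 1 / 2.
  by apply: le_trans ha; rewrite exprS -mulrA ler_peMl.
rewrite (sum_exec_prob_cons h
  (fun w => (foldl (@step V k) I (take t.+1 w) == setT)%:R)) /=.
apply: (@le_trans _ _ (\sum_(x : round V k) round_prob R e x *
   expR (growth ^+ t * a * #|step I x|%:R) * expR (- (a * #|V|%:R)))).
  apply: ler_sum => x _; rewrite -mulrA -expRD ler_wpM2l ?round_prob_ge0 //.
  exact: IH.
rewrite -mulr_suml expRD ler_wpM2r ?expR_ge0 // exprS -mulrA.
by apply: le_trans (round_exp_moment _ _) _; rewrite ?mulrA // ga0.
Qed.

Lemma prob_time_ge_lower (v0 : V) h t (r : R) : 1 <= growth -> (t <= h)%N ->
  r <= t.+1%:R ->
  1 - expR (1 / 2 - #|V|%:R / (2 * growth ^+ t)) <= prob_time_ge k e v0 h r.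
Proof.
move=> g1 th rt; rewrite prob_time_geE lerD2l lerN2.
have gt0 : 0 < growth ^+ t by rewrite exprn_gt0 // (lt_le_trans _ g1).
(* The largest [a] for which the moment bound covers t rounds. *)
pose a := 1 / (2 * growth ^+ t).
have ga : growth ^+ t * a = 1 / 2 by rewrite /a; field; rewrite gt_eqF.
have a0 : 0 <= a by rewrite divr_ge0 // mulr_ge0 // ltW.
have := informed_all_exp_moment [set v0] a0 g1 _ th.
rewrite ga cards1 mulr1 (_ : a * _ = #|V|%:R / (2 * growth ^+ t)); last first.
  by rewrite /a mulrAC mul1r.
move=> /(_ (lexx _)); apply: le_trans; rewrite big_mkcond; apply: ler_sum => w _.
case: ifPn => [cr|_]; last by rewrite mulr_ge0 // exec_prob_ge0.
have ct : (completion_time v0 w <= t)%N.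
  by rewrite -ltnS -(ltr_nat R); apply: lt_le_trans cr rt.
have := informed_mono v0 w ct.
rewrite completion_time_informed ?size_tuple; last exact: leq_trans ct th.
by rewrite subTset /informed => ->; rewrite mulr1.
Qed.

End ExponentialMoment.
End Protocol.

(** * Speed of the rumor along a function that changes by at most one per edge *)

Section Lipschitz.
Variables (V : finType) (k : nat) (R : realType) (e : rel V) (f : V -> nat).
Hypothesis lip : forall u v, e u v -> (f u <= (f v).+1)%N /\ (f v <= (f u).+1)%N.

Lemma mem_neighbors1 u v : (v \in neighbors e [set u]) = e u v.
Proof.
rewrite inE; apply/existsP/idP => [[w]|uv]; last by exists u; rewrite inE eqxx.
by rewrite inE => /andP[/eqP->].
Qed.

Lemma contacts_lip u v : v \in contacts e u ->
  (f u <= (f v).+1)%N /\ (f v <= (f u).+1)%N.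
Proof.
rewrite /contacts; case: ifP => _; last by rewrite mem_neighbors1; apply: lip.
by rewrite inE => /eqP->.
Qed.

Lemma round_prob_support (x : round V k) v j :
  round_prob R e x != 0 -> x v j \in contacts e v.
Proof.
move=> /prodf_neq0/(_ v isT)/prodf_neq0/(_ j isT).
by rewrite /sample_prob; case: (_ \in _); rewrite // mul0r eqxx.
Qed.

(** In a round of nonzero probability every sample is a contact, so the rumor crosses at most one
    edge and the range of [f] around [m] widens by at most one each way. *)
Lemma foldl_step_lip (w : seq (round V k)) (I : {set V}) m s :
  exec_prob R e w != 0 ->
  (forall v, v \in I -> (f v <= m + s /\ m <= f v + s)%N) ->
  forall v, v \in foldl (@step V k) I w ->
  (f v <= m + (s + size w) /\ m <= f v + (s + size w))%N.
Proof.
elim: w I s => [|x w IH] I s; first by move=> _ HI v /HI; rewrite addn0.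
rewrite /exec_prob big_cons mulf_eq0 negb_or => /andP[x0 w0] HI v.
rewrite [foldl _ _ _]/= [size _]/= -addSnnS; apply: (IH _ s.+1 w0) => u; rewrite inE.
case/or3P => [/HI||].
- lia.
- case/existsP => y /andP[/HI Hy /existsP[j /eqP xj]].
  by have /contacts_lip := round_prob_support y j x0; rewrite xj; lia.
- case/existsP => j /HI Hy.
  by have /contacts_lip := round_prob_support u j x0; lia.
Qed.

Lemma informed_lip (w : seq (round V k)) v0 t v :
  exec_prob R e w != 0 -> v \in informed v0 w t ->
  (f v <= f v0 + t)%N /\ (f v0 <= f v + t)%N.
Proof.
rewrite /exec_prob -[w in \prod_(_ <- w) _](cat_take_drop t) big_cat mulf_eq0.
rewrite negb_or => /andP[w0 _] vI.
have init u : u \in [set v0] -> (f u <= f v0 + 0 /\ f v0 <= f u + 0)%N.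
  by rewrite inE => /eqP->; lia.
have := foldl_step_lip w0 init vI; have := geq_minl t (size w).
by rewrite -size_take_min; lia.
Qed.

(** The rumor travels from [v0] to both [u] and [v]; going through the unknown value [f v0] costs
    the factor 2. *)
Lemma completion_time_lip (w : seq (round V k)) v0 u v :
  exec_prob R e w != 0 -> (completion_time v0 w <= size w)%N ->
  (f v <= f u + 2 * completion_time v0 w)%N.
Proof.
move=> w0 /completion_time_informed ct.
have uI : u \in [set: V] by []; have vI : v \in [set: V] by [].
rewrite -ct in uI vI.
have := informed_lip w0 uI; have := informed_lip w0 vI; lia.
Qed.

End Lipschitz.

Lemma card_ord_interval n m p : (p <= n)%N ->
  #|[set i : 'I_n | (m <= i < p)%N]| = (p - m)%N.
Proof.
move=> pn; rewrite -sum1dep_card -(big_mkord (fun i => m <= i < p)%N (fun=> 1%N)).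
transitivity (\sum_(m <= i < p) 1)%N; last by rewrite sum_nat_const_nat muln1.
by rewrite (big_nat_widenl m 0) // (big_nat_widen 0 p n).
Qed.

(** * The layered graph and its expansion *)

Section LayeredGraph.
Variables (b D n : nat).
Hypothesis b_gt1 : (1 < b)%N.

(** Layer j < D holds the indices from b^j - 1 to b^(j+1) - 2, and layer D all later ones. With D =
    0 the graph is complete. *)
Definition layer (v : nat) : nat := minn D (trunc_log b v.+1).

Definition layered : rel 'I_n := fun u v =>
  [&& u != v, layer u <= (layer v).+1 & layer v <= (layer u).+1]%N.

Lemma leq_layer j v : (j <= layer v)%N = (j <= D)%N && (b ^ j <= v.+1)%N.
Proof.
rewrite leq_min; congr andb; apply/idP/idP => [jv|]; last exact: trunc_log_max.
apply: leq_trans (trunc_logP b_gt1 (ltn0Sn v)).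
by rewrite leq_exp2l.
Qed.

Lemma layered_simple : simple_graph layered.
Proof.
split=> [u v|u]; last by rewrite /layered eqxx.
by rewrite /layered eq_sym; congr andb; apply: andbC.
Qed.

Lemma mem_boundary (S : {set 'I_n}) u v :
  u \in S -> v \notin S -> (layer u <= (layer v).+1)%N ->
  (layer v <= (layer u).+1)%N -> v \in boundary layered S.
Proof.
move=> uS vS uv vu; rewrite !inE vS; apply/existsP; exists u.
rewrite uS /layered uv vu !andbT /=.
by apply: contraNneq vS => <-.
Qed.

(* A set whose deepest node lies in an inner layer sees the whole next layer,
   which is [b - 1] times larger than everything up to its own layer; a set
   reaching the last layer sees the rest of that layer, which contains at least
   4/5 of all nodes. *)
Lemma layered_expander (R : realType) (phi alpha : R) :
  1 <= phi -> phi + 1 <= b%:R -> (5 <= b)%N ->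
  alpha <= 1 / (1 + 16 / 10 * phi) ->
  D = 0%N \/ (b ^ D.+1 <= n)%N -> is_expander phi alpha layered.
Proof.
move=> phi1 phib b5 ha HD S S0; rewrite card_ord => Sn.
have {Sn} Sn : #|S|%:R * (1 + 16 / 10 * phi) <= n%:R.
  rewrite -ler_pdivlMr; last lra.
  apply: le_trans Sn _; rewrite mulrC ler_wpM2l //.
  by apply: le_trans ha _; rewrite div1r.
have [u0 u0S] : exists u, u \in S by apply/set0Pn; rewrite -card_gt0.
pose u := [arg max_(v > u0 in S) layer v].
have [uS umax] : u \in S /\ (forall v, v \in S -> (layer v <= layer u)%N).
  by rewrite /u; case: arg_maxnP.
have uD : (layer u <= D)%N by apply: geq_minl.
have [jD|jD] := leqP D (layer u).
  (* At most n/5 nodes lie outside the last layer, so the boundary has at least 4n/5 - |S| nodes. As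
     n >= (1 + 1.6 phi) |S|, this is at least (1.28 phi - 0.2) |S| >= phi |S|. *)
  have bD : (5 * (b ^ D).-1 <= n)%N.
    case: HD => [->|]; first by rewrite expn0.
    rewrite expnS; have : (0 < b ^ D)%N by rewrite expn_gt0; lia.
    nia.
  have bDn : ((b ^ D).-1 <= n)%N by lia.
  pose L := [set i : 'I_n | ((b ^ D).-1 <= i < n)%N].
  have sub : L :\: S \subset boundary layered S.
    apply/subsetP => v; rewrite !in_setD => /andP[vS]; rewrite inE => /andP[Dv _].
    have lv : (D <= layer v)%N by rewrite leq_layer leqnn; lia.
    have lvD : (layer v <= D)%N by apply: geq_minl.
    by rewrite -in_setD; apply: (mem_boundary uS vS); lia.
  have := subset_leq_card sub; rewrite cardsD card_ord_interval //.
  have := subset_leq_card (subsetIr L S) => IS card.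
  have : (n <= #|boundary layered S| + #|S| + (b ^ D).-1)%N by lia.
  rewrite -(ler_nat R) !natrD.
  move: bD; rewrite -(ler_nat R) natrM => bD.
  have : 1 <= #|S|%:R :> R by rewrite ler1n.
  by nra.
set j := layer u in umax uD jD.
have Sj : (#|S| <= b ^ j.+1)%N.
  apply: leq_trans (_ : #|[set i : 'I_n | (0 <= i < b ^ j.+1)%N]| <= _)%N.
    apply: subset_leq_card; apply/subsetP => v vS; rewrite inE /=.
    have := leq_layer j.+1 v; rewrite jD /= => bv.
    by rewrite ltnNge; apply/negP => h; have := umax _ vS; rewrite leqNgt bv; lia.
  rewrite -[X in (_ <= X)%N]subn0.
  have [le|/ltnW le] := leqP (b ^ j.+1) n; first by rewrite card_ord_interval.
  by apply: leq_trans (max_card _) _; rewrite card_ord subn0.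
have bn : (b ^ j.+2 <= n)%N.
  case: HD => [D0|HD]; first by rewrite D0 in jD.
  by apply: leq_trans HD; rewrite leq_exp2l //; lia.
(* These (b - 1) b^(j+1) nodes lie in layer j + 1, deeper than all of S; if j + 1 = D they may be
   only part of that layer. *)
pose L := [set i : 'I_n | ((b ^ j.+1).-1 <= i < (b ^ j.+2).-1)%N].
have b0 m : (0 < b ^ m)%N by rewrite expn_gt0; lia.
have sub : L \subset boundary layered S.
  apply/subsetP => v; rewrite inE => /andP[jv vj].
  have lv : (j < layer v)%N by rewrite leq_layer jD; have := b0 j.+1; lia.
  have lvj : (layer v <= j.+1)%N.
    by rewrite leqNgt leq_layer negb_and; have := b0 j.+2; lia.
  apply: (mem_boundary uS); last 2 first; rewrite -/j; try lia.
  by apply/negP => /umax; rewrite leqNgt lv.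
have := subset_leq_card sub; rewrite card_ord_interval; last lia.
move=> card.
have : (b * b ^ j.+1 <= #|boundary layered S| + b ^ j.+1)%N.
  by rewrite -expnS; have := b0 j.+1; have := b0 j.+2; lia.
rewrite -(ler_nat R) natrD natrM.
move: Sj; rewrite -(ler_nat R); set q : R := (b ^ _)%:R => Sq bq.
have phi0 : 0 <= phi by lra.
have := ler_wpM2l phi0 Sq; have := ler_wpM2r (ler0n R (b ^ j.+1)) phib.
rewrite -/q; lra.
Qed.

End LayeredGraph.

(** * Time lower bounds on the layered and the complete graph *)

(** Provides B = 1 for the complete graph: each of the n - 1 other nodes samples [u] with
    probability 1/(n - 1). A single node samples itself. *)
Lemma layered0_sample_prob (R : realType) (b n : nat) (u : 'I_n) :
  \sum_v sample_prob R (@layered b 0 n) v u <= 1.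
Proof.
pose e := @layered b 0 n.
have eE v w : e v w = (v != w) by rewrite /e /layered /layer !min0n andbT.
have nE v : neighbors e [set v] = [set~ v].
  by apply/setP => w; rewrite mem_neighbors1 eE !inE eq_sym.
have cardC (v : 'I_n) : #|[set~ v]| = n.-1.
  by rewrite cardsC1 card_ord.
have [n1|n1] := leqP n 1.
  rewrite (bigD1 u) //= big1 ?addr0 => [|v /eqP vu]; last first.
    by case: vu; apply/val_inj => /=; have := ltn_ord u; have := ltn_ord v; lia.
  rewrite /sample_prob ler_pdivrMr ?ltr0n ?contacts_gt0 // mul1r ler_nat.
  exact: leq_trans (leq_b1 _) (contacts_gt0 _ _).
have cE v : contacts e v = [set~ v].
  rewrite /contacts nE; case: ifPn => // /eqP/(congr1 (fun A : {set _} => #|A|)).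
  by rewrite cards0 cardC; lia.
rewrite /sample_prob; under eq_bigr do rewrite -/e cE cardC.
rewrite -mulr_suml ler_pdivrMr ?ltr0n; last lia.
rewrite mul1r -natr_sum ler_nat -(cardC u) -sum1_card [X in (_ <= X)%N]big_mkcond.
by apply: leq_sum => v _; rewrite !inE eq_sym; case: eqP.
Qed.

Lemma layered_time_lower (R : realType) (b n k : nat) (v0 : 'I_n) h (r : R) :
  (1 < b)%N -> (1 < n)%N -> r <= h%:R -> 8 * r * ln b%:R <= ln n%:R ->
  prob_time_ge k (@layered b (trunc_log b n).-1 n) v0 h r = 1.
Proof.
move=> b1 n1 rh rb; set m := trunc_log b n; set e := @layered _ _ _.
apply: prob_time_ge1 => w w0.
have [ct|ct] := leqP (completion_time v0 w) h; last first.
  by apply: le_trans rh _; rewrite ler_nat ltnW.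
have ct0 : (0 < completion_time v0 w)%N by rewrite completion_time_gt0 // card_ord.
have lip (u v : 'I_n) : e u v ->
  (layer b m.-1 u <= (layer b m.-1 v).+1)%N /\ (layer b m.-1 v <= (layer b m.-1 u).+1)%N.
  by case/and3P.
pose first := Ordinal (ltnW n1 : (0 < n)%N).
have nn : (n.-1 < n)%N by lia.
pose last := Ordinal nn.
have := completion_time_lip (v0 := v0) lip first last w0.
have /= : (m.-1 <= layer b m.-1 last)%N.
  rewrite leq_layer // leqnn /= prednK; last lia.
  apply: leq_trans (trunc_logP b1 _); last lia.
  by rewrite leq_exp2l // leq_pred.
have /= -> : layer b m.-1 first = 0%N by rewrite /layer trunc_log1 minn0.
rewrite size_tuple => Dm /(_ ct) Dct.
have lb0 : 0 < ln b%:R :> R by rewrite ln_gt0 // ltr1n.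
have Ln : ln n%:R <= m.+1%:R * ln b%:R :> R.
  rewrite mulr_natl -lnXn ?ltr0n; last lia.
  rewrite ler_ln ?posrE -?natrX ?ltr0n ?expn_gt0 ?ler_nat; try lia.
  by apply/ltnW/trunc_log_ltn.
have : 8 * r <= m.+1%:R by rewrite -(ler_pM2r lb0) (le_trans rb).
(* With T >= 1 the completion time, m - 1 <= 2T gives m + 1 <= 2T + 2 <= 8T. *)
have : (m.+1 <= 8 * completion_time v0 w)%N by lia.
rewrite -(ler_nat R) natrM; lra.
Qed.

Lemma complete_time_lower (R : realType) (b n k : nat) (v0 : 'I_n) h (c r : R) :
  (1 < n)%N -> (1 < k)%N -> 0 <= r <= h%:R -> 6 * r * ln k%:R <= ln n%:R ->
  16 * c <= ln n%:R ->
  1 - n%:R `^ (- c) <= prob_time_ge k (@layered b 0 n) v0 h r.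
Proof.
move=> n1 k1 /andP[r0 rh] rk cn.
(* A completion time below r is at most t, the integer part of r. *)
have /andP[tr rt] := truncn_itv r0; set t := Num.trunc r in tr rt.
have th : (t <= h)%N by rewrite -(ler_nat R) (le_trans tr).
have k0 : 1 < k%:R :> R by rewrite ltr1n.
have L0 : 0 < ln n%:R :> R by rewrite ln_gt0 // ltr1n.
pose g : R := 1 + k%:R + 2 * k%:R * 1.
have g1 : 1 <= g by rewrite /g; lra.
have := prob_time_ge_lower (layered0_sample_prob R b (n:=n)) v0 g1 th (ltW rt).
apply: le_trans; rewrite lerD2l lerN2 card_ord -/g.
rewrite /powR pnatr_eq0 -[n == 0%N]negbK -lt0n (ltnW n1) ler_expR.
have gt0 : 0 < g ^+ t by rewrite exprn_gt0 // (lt_le_trans _ g1).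
have gle : g ^+ t <= expR (ln n%:R / 2).
  (* 1 + 3k <= k^3 for k >= 2, so 6 r ln k <= ln n yields g^t <= sqrt n. *)
  have gk : g <= k%:R ^+ 3.
    by rewrite /g; have : 2 <= k%:R :> R; [rewrite ler_nat | nra].
  have g_ge0 : 0 <= g by rewrite (le_trans _ g1).
  apply: (@le_trans _ _ ((k%:R ^+ 3) ^+ t)); first by rewrite lerXn2r ?nnegrE ?exprn_ge0.
  have kpos : k%:R \is @Num.pos R by rewrite posrE (lt_trans _ k0).
  rewrite -exprM -[k%:R]lnK // -expRM_natl ler_expR natrM.
  by have := ler_wpM2r (ltW (ln_gt0 k0)) tr; lra.
have nE : n%:R = expR (ln n%:R / 2) ^+ 2 :> R.
  rewrite -expRM_natl mulrCA divff ?pnatr_eq0 // mulr1 lnK // posrE ltr0n; lia.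
have := @expR_ge1Dxn R (ln n%:R / 2) 1; rewrite divr_ge0 ?(ltW L0) // => /(_ isT) E.
suff : 1 / 2 + c * ln n%:R <= n%:R / (2 * g ^+ t) by lra.
rewrite ler_pdivlMr; last by rewrite mulr_gt0.
rewrite {2}nE.
have E0 := expR_gt0 (ln n%:R / 2 : R).
set X := expR _ in gle E E0 *; set L := ln _ in cn L0 E *.
(* X is sqrt n. The quadratic term of the exponential dominates 2cL exactly because 16c <= L. *)
have X1 : 1 + L ^+ 2 / 8 <= X by move: E; rewrite !factS fact0; lra.
have cL : 1 + 2 * (c * L) <= X by nra.
have : (1 + 2 * (c * L)) * g ^+ t <= X * X; last by lra.
have [c0|/ltW c0] := leP 0 (1 + 2 * (c * L)).
  by apply: ler_pM => //; exact: ltW.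
by apply: (@le_trans _ _ 0); [rewrite mulr_le0_ge0 // ltW | rewrite mulr_ge0 // ltW].
Qed.

(** * Choice of the constants and of the graph *)

(** The exponent [c] is arbitrary, and [C] depends only on [c] and [phi0]. Keeping phi at least
    [phi0] > 1 makes ln b and ln phi comparable uniformly. *)
Theorem theorem1p3 (R : realType) (c phi0 : R) (hc : 0 < c)
    (hphi0 : 1 < phi0) :
  exists2 C : R, 0 < C &
  forall (n k : nat) (phi alpha : R),
    (1 <= n)%N -> phi0 <= phi -> phi < n%:R ->
    0 < alpha -> alpha <= 1 / (1 + 16 / 10 * phi) -> (2 <= k)%N ->
  exists e : rel 'I_n,
    [/\ simple_graph e,
        is_expander phi alpha e
      & forall (v0 : 'I_n) (h : nat),
          C * (log phi n%:R + log k%:R n%:R) <= h%:R ->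
          1 - n%:R `^ (- c) <=
            prob_time_ge k e v0 h (C * (log phi n%:R + log k%:R n%:R))].
Proof.
(* Chosen so that b <= phi + 5 <= 6 phi implies ln b <= kappa ln phi. *)
pose kappa : R := 1 + ln 6 / ln phi0.
have lphi0 : 0 < ln phi0 by rewrite ln_gt0.
have ln2 : 0 < ln 2 :> R by rewrite ln_gt0 // ltr1n.
have ln6 : 0 < ln 6 :> R by rewrite ln_gt0 // ltr1n.
have kappa1 : 1 <= kappa by rewrite lerDl divr_ge0 // ltW.
have cln2 : 0 < c / ln 2 by rewrite divr_gt0.
(* The first term serves the two time bounds; the second forces T <= 1 when ln n < 16c on the
   complete graph. Both are doubled because the sum of the two logarithms is at most twice the
   larger. *)
pose A := 16 * kappa + 32 * (c / ln 2).
have A0 : 0 < A by rewrite /A; lra.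
exists A^-1 => [|n k phi alpha n1 phi0le phin alpha0 ha k2]; first by rewrite invr_gt0.
have phi1 : 1 < phi by apply: lt_le_trans phi0le.
have n2 : (1 < n)%N by rewrite -(ltr_nat R) (lt_trans phi1).
pose b := (Num.trunc phi + 5)%N.
have [bphi phib] : b%:R <= phi + 5 /\ phi + 1 <= b%:R.
  have phi_ge0 : 0 <= phi by lra.
  have /andP[] := truncn_itv phi_ge0.
  by rewrite /b -addn1 !natrD; lra.
have b5 : (5 <= b)%N by rewrite leq_addl.
have b1 : (1 < b)%N by exact: leq_trans b5.
rewrite /log; set L := ln n%:R.
have L0 : 0 < L by rewrite ln_gt0 // ltr1n.
have lnphi : ln phi0 <= ln phi by rewrite ler_ln ?posrE //; lra.
have lnk : ln 2 <= ln k%:R :> R.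
  by rewrite ler_ln ?posrE ?ltr0n ?ler_nat // ltnW.
have lphi : 0 < ln phi by lra.
have lk : 0 < ln k%:R :> R by lra.
set T := A^-1 * _.
have TA : T * A = L / ln phi + L / ln k%:R by rewrite /T mulrC mulVKf // gt_eqF.
have T0 : 0 <= T by apply: mulr_ge0; [rewrite invr_ge0 ltW | rewrite addr_ge0 ?divr_ge0 // ltW].
have T16 : 16 * kappa * T <= T * A.
  by rewrite mulrC ler_wpM2l // /A; lra.
have T32 : 32 * (c / ln 2) * T <= T * A.
  by rewrite mulrC ler_wpM2l // /A; lra.
(* With at least two nodes, at least one round is always required. *)
have Tge1 (D : nat) (v0 : 'I_n) h : T <= 1 -> T <= h%:R ->
    1 - n%:R `^ (- c) <= prob_time_ge k (@layered b D n) v0 h T.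
  move=> T1 Th; rewrite prob_time_ge1 ?gerBl ?powR_ge0 // => w _.
  by apply: le_trans T1 _; rewrite ler1n completion_time_gt0 // card_ord.
have [lephik|ltkphi] := leP (ln phi) (ln k%:R).
  exists (@layered b (trunc_log b n).-1 n); split; first exact: layered_simple.
  - apply: layered_expander ha _ => //; first exact: ltW.
    case E: (trunc_log b n) => [|m]; [by left | right].
    by rewrite /= -E trunc_logP.
  move=> v0 h Th; rewrite layered_time_lower ?gerBl ?powR_ge0 //.
  have lnb : ln b%:R <= kappa * ln phi.
    have : ln b%:R <= ln (6 * phi).
      by rewrite ler_ln ?posrE ?ltr0n ?mulr_gt0 ?(ltnW b1) //; lra.
    rewrite lnM ?posrE //; last lra.
    move=> /le_trans; apply; rewrite /kappa mulrDl mul1r addrC lerD2l.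
    by rewrite mulrAC ler_pdivlMr // ler_wpM2l // ltW.
  have : L / ln k%:R <= L / ln phi.
    by rewrite ler_pM2l // lef_pV2.
  move=> Lk.
  have : 8 * kappa * T <= L / ln phi by lra.
  by rewrite ler_pdivlMr // -/L; have := ler_wpM2l T0 lnb; lra.
exists (@layered b 0 n); split; first exact: layered_simple.
- by apply: layered_expander ha _ => //; [exact: ltW | left].
move=> v0 h Th.
have Lk : L / ln phi <= L / ln k%:R by rewrite ler_pM2l // lef_pV2 // ltW.
(* For small n the moment bound is too weak, but then 16cT <= L < 16c, hence T < 1. *)
have [cL|Lc] := leP (16 * c) L.
  apply: complete_time_lower; rewrite // ?T0 //.
  by rewrite -ler_pdivlMr // -/L; have := ler_wpM2r T0 kappa1; lra.
apply: Tge1 => //.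
have : 16 * (c / ln 2) * T <= L / ln 2.
  have : L / ln k%:R <= L / ln 2 by rewrite ler_pM2l // lef_pV2.
  lra.
have -> : 16 * (c / ln 2) * T = 16 * c * T / ln 2 by rewrite mulrA mulrAC.
rewrite ler_pM2r ?invr_gt0 // => cT.
by rewrite -(ler_pM2l hc); lra.
Qed.
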